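(* Let $f,g,F=f+g$, a Bregman distance $D$ and a parameter $\epsilon$ be as in the context, with $\overline\epsilon<\frac mL$. Let $\overline x\in\mathrm{dom}F$, $\overline F=F(\overline x)$, and assume the level-set subdifferential error bound holds at $\overline x$ with exponent $\gamma\in(0,\infty)$ over $\mathfrak{B}(\overline x;\eta,\nu)$. Then there are $N>\frac{2\overline\epsilon\nu}{m-\overline\epsilon L}\big/\left(\frac\eta2\right)^2$ and $\theta>0$ such that $$\mathrm{dist}^p(x,[F\le\overline F])\le\theta\,\mathrm{dist}(x,T_{D,\epsilon}(x))\quad\text{with } p=\frac{1}{\min\{\frac1\gamma,1\}},\qquad\forall x\in\mathfrak{B}\left(\overline x;\tfrac\eta2,\tfrac\nu N\right).$$ As a consequence, $p=1$ if $\gamma\in(0,1]$ and $p=\gamma$ if $\gamma\in(1,\infty)$.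
   Context: Assumptions on $f,g$: $f:\mathbb{R}^n\to(-\infty,\infty]$ is a proper lower semicontinuous (possibly nonconvex) function, differentiable on $\mathrm{dom} f$, with $\mathrm{dom} f$ convex and $\nabla f$ $L$-Lipschitz continuous on $\mathrm{dom} f$; $g:\mathbb{R}^n\to(-\infty,\infty]$ is proper, lower semicontinuous (possibly nonconvex and nonsmooth), continuous on $\mathrm{dom} g$, and $\mathrm{dom} g$ is convex; $F=f+g$ is level-bounded, i.e. $\{x: F(x)\le r\}$ is bounded (possibly empty) for every $r\in\mathbb{R}$. Bregman distance: $K:\mathbb{R}^n\to\mathbb{R}$ is twice differentiable, strongly convex with modulus $m>0$, with $\nabla K$ $M$-Lipschitz, and $D(x,y)=K(y)-[K(x)+\langle\nabla K(x),y-x\rangle]$. The parameter satisfies $0<\underline\epsilon\le\epsilon\le\overline\epsilon$. The Bregman proximal mapping is $T_{D,\epsilon}(x)=\arg\min_{y}\{\langle\nabla f(x),y-x\rangle+g(y)+\frac1\epsilon D(x,y)\}$. Proximal subdifferential: $\partial_P\psi(\bar x)=\{\xi:\exists \rho>0,r>0 \text{ s.t. } \psi(x)\ge\psi(\bar x)+\langle\xi,x-\bar x\rangle-\rho\|x-\bar x\|^2\ \forall x\in\mathbb{B}(\bar x;r)\}$, $\mathbb{B}$ the open ball. $[F\le\overline F]=\{x:F(x)\le\overline F\}$, $\mathrm{dist}(x,C)=\inf_{z\in C}\|x-z\|$ ($=\infty$ if $C=\emptyset$), and $\mathfrak{B}(\overline x;\eta,\nu)=\mathbb{B}(\overline x;\eta)\cap\{x:\overline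 F<F(x)<\overline F+\nu\}$. The level-set subdifferential error bound holds at $\overline x$ with exponent $\gamma>0$ over $\mathfrak{B}(\overline x;\eta,\nu)$ ($\eta,\nu>0$) if there is $c_3>0$ with $\mathrm{dist}^\gamma(x,[F\le\overline F])\le c_3\,\mathrm{dist}(0,\partial_PF(x))$ for all $x\in\mathfrak{B}(\overline x;\eta,\nu)$. *)

(* Defs.v *)
From HB Require Import structures.
From mathcomp Require Import all_boot all_order all_algebra.
From mathcomp Require Import all_classical all_reals all_analysis.

Set Implicit Arguments.
Unset Strict Implicit.
Unset Printing Implicit Defensive.

Import Order.TTheory GRing.Theory Num.Theory numFieldNormedType.Exports.

Local Open Scope classical_set_scope.
Local Open Scope ring_scope.

(* R^n is 'rV[R]_n. The library norm `|x| on 'rV[R]_n is the max norm; all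
   distances, balls and Lipschitz constants below use the Euclidean norm enorm.
   The max norm only enters through topological notions (semicontinuity,
   continuity, differentiability, boundedness), for which the two norms are
   equivalent. *)
Definition dotv (R : realType) (n : nat) (x y : 'rV[R]_n) : R :=
  \sum_(i < n) x 0 i * y 0 i.

Definition enorm (R : realType) (n : nat) (x : 'rV[R]_n) : R :=
  Num.sqrt (dotv x x).

Definition eball (R : realType) (n : nat) (x : 'rV[R]_n) (r : R) :
    set 'rV[R]_n :=
  [set y | enorm (y - x) < r].

Definition edist_set (R : realType) (n : nat) (x : 'rV[R]_n)
    (C : set 'rV[R]_n) : \bar R :=
  ereal_inf [set (enorm (x - z))%:E | z in C].

Definition edom (R : realType) (n : nat) (h : 'rV[R]_n -> \bar R) :
    set 'rV[R]_n :=
  [set x | (h x < +oo)%E].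

Definition proper_fun (R : realType) (n : nat) (h : 'rV[R]_n -> \bar R) : Prop :=
  (forall x, h x != -oo%E) /\ edom h !=set0.

Definition level_set (R : realType) (n : nat) (h : 'rV[R]_n -> \bar R)
    (a : \bar R) : set 'rV[R]_n :=
  [set x | (h x <= a)%E].

Definition level_bounded (R : realType) (n : nat) (h : 'rV[R]_n -> \bar R) :
    Prop :=
  forall r : R, bounded_set (level_set h r%:E).

Definition grad (R : realType) (n : nat) (h : 'rV[R]_n -> R) (x : 'rV[R]_n) :
    'rV[R]_n :=
  \row_i 'D_(delta_mx 0 i) h x.

(* Ordinary (not relative) differentiability at every point of the domain:
   the extended real-valued function must be finite near the point. *)
Definition differentiable_on_dom (R : realType) (n : nat)
    (h : 'rV[R]_n -> \bar R) : Prop :=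
  forall x, edom h x -> (edom h)° x /\ differentiable (fine \o h) x.

Definition elipschitz_on (R : realType) (n : nat) (A : set 'rV[R]_n) (L : R)
    (G : 'rV[R]_n -> 'rV[R]_n) : Prop :=
  forall x y, A x -> A y -> enorm (G x - G y) <= L * enorm (x - y).

Definition twice_differentiable (R : realType) (n : nat) (K : 'rV[R]_n -> R) :
    Prop :=
  (forall x, differentiable K x) /\ (forall x, differentiable (grad K) x).

Definition strongly_convex (R : realType) (n : nat) (m : R)
    (K : 'rV[R]_n -> R) : Prop :=
  forall (x y : 'rV[R]_n) (t : R), 0 <= t <= 1 ->
    K (t *: x + (1 - t) *: y) <=
    t * K x + (1 - t) * K y - m / 2 * t * (1 - t) * enorm (x - y) ^+ 2.

Definition bregman (R : realType) (n : nat) (K : 'rV[R]_n -> R)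
    (x y : 'rV[R]_n) : R :=
  K y - (K x + dotv (grad K x) (y - x)).

Definition argmin (R : realType) (T : Type) (h : T -> \bar R) : set T :=
  [set y | forall z, (h y <= h z)%E].

Definition bregman_prox (R : realType) (n : nat) (f g : 'rV[R]_n -> \bar R)
    (K : 'rV[R]_n -> R) (eps : R) (x : 'rV[R]_n) : set 'rV[R]_n :=
  argmin (fun y => (dotv (grad (fine \o f) x) (y - x))%:E + g y
                   + (1 / eps * bregman K x y)%:E)%E.

Definition prox_subdiff (R : realType) (n : nat) (h : 'rV[R]_n -> \bar R)
    (x : 'rV[R]_n) : set 'rV[R]_n :=
  [set xi | exists rho r : R, [/\ 0 < rho, 0 < r &
    forall y, eball x r y ->
      (h x + (dotv xi (y - x))%:E - (rho * enorm (y - x) ^+ 2)%:E <= h y)%E]].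

Definition level_ball (R : realType) (n : nat) (h : 'rV[R]_n -> \bar R)
    (xbar : 'rV[R]_n) (eta nu : R) : set 'rV[R]_n :=
  eball xbar eta `&` [set x | (h xbar < h x < h xbar + nu%:E)%E].

Definition level_subdiff_error_bound (R : realType) (n : nat)
    (h : 'rV[R]_n -> \bar R) (xbar : 'rV[R]_n) (gamma eta nu : R) : Prop :=
  exists2 c3 : R, 0 < c3 & forall x, level_ball h xbar eta nu x ->
    (edist_set x (level_set h (h xbar)) `^ gamma <=
     c3%:E * edist_set 0%R (prox_subdiff h x))%E.

(* Main.v *)
Require Import Defs.
From HB Require Import structures.
From mathcomp Require Import all_boot all_order all_algebra.
From mathcomp Require Import all_classical all_reals all_analysis.
From mathcomp Require Import ring lra.

Set Implicit Arguments.
Unset Strict Implicit.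
Unset Printing Implicit Defensive.

Import Order.TTheory GRing.Theory Num.Theory numFieldNormedType.Exports.

Local Open Scope classical_set_scope.
Local Open Scope ring_scope.

(** The error bound controls the distance to the level set [F <= F(xbar)] by the
size of proximal subgradients of F; the claim is that the length of one Bregman
proximal step controls it as well.  Fix x near xbar and y in T(x), and put
r = |x - y|; the bound is proved for each such y and then passes to the
infimum over T(x), which is trivially fine when T(x) is empty.

Comparing y with x in the minimisation defining T(x), and using the quadratic
upper bound of f ([descent]) and the quadratic lower bound of the Bregman
distance ([bregman_ge]), gives the decrease
(m / eps - L) / 2 * r ^ 2 <= F(x) - F(y) ([bregman_prox_decrease]).  Comparing y
with an arbitrary z gives a proximal subgradient of F at y of norm at most
(L + |M| / eps) * r ([bregman_prox_subdiff]).

If F(y) <= F(xbar), the distance of x to the level set is at most r.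
Otherwise F(xbar) < F(y) <= F(x), and the decrease forces r < eta / 2 as soon as
F(x) - F(xbar) is below nu / N; so y lies in the region where the error bound
holds, which makes dist(y) ^ gamma at most a multiple of r.  The distance is
1-Lipschitz, hence dist(x) <= r + dist(y), and [powR_error_transfer] turns these
estimates into dist(x) ^ p <= theta * r for p = max(gamma, 1).

The minimisation defining T(x) does not constrain y to dom f, so f(y) = +oo has
to be ruled out.  This is [edom_setT]: a lower semicontinuous function that is
differentiable with a Lipschitz gradient on a convex domain, which is then open,
is finite everywhere. *)

(** * The Euclidean inner product and norm *)

Section Euclidean.
Context {R : realType} {n : nat}.
Implicit Types (x y z u v : 'rV[R]_n) (t : R).

Lemma dotvC x y : dotv x y = dotv y x.
Proof. by apply: eq_bigr => i _; rewrite mulrC. Qed.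

Lemma dotvDl x y z : dotv (x + y) z = dotv x z + dotv y z.
Proof. by rewrite -big_split; apply: eq_bigr => i _; rewrite mxE mulrDl. Qed.

Lemma dotvZl t x y : dotv (t *: x) y = t * dotv x y.
Proof. by rewrite /dotv mulr_sumr; apply: eq_bigr => i _; rewrite mxE mulrA. Qed.

Lemma dotvDr x y z : dotv x (y + z) = dotv x y + dotv x z.
Proof. by rewrite dotvC dotvDl !(dotvC x). Qed.

Lemma dotvZr t x y : dotv x (t *: y) = t * dotv x y.
Proof. by rewrite dotvC dotvZl dotvC. Qed.

Lemma dotvNl x y : dotv (- x) y = - dotv x y.
Proof. by rewrite -scaleN1r dotvZl mulN1r. Qed.

Lemma dotvNr x y : dotv x (- y) = - dotv x y.
Proof. by rewrite dotvC dotvNl dotvC. Qed.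

Definition dotvE := (dotvDl, dotvDr, dotvNl, dotvNr, dotvZl, dotvZr).

Lemma dotvv_ge0 x : 0 <= dotv x x.
Proof. by apply: sumr_ge0 => i _; rewrite -expr2 sqr_ge0. Qed.

Lemma dotvv_eq0 x : dotv x x = 0 -> x = 0.
Proof.
move=> /eqP; rewrite psumr_eq0 => [/allP x0|i _]; last by rewrite -expr2 sqr_ge0.
apply/rowP => i; rewrite mxE; apply/eqP.
by have := x0 i (mem_index_enum _); rewrite mulf_eq0 orbb.
Qed.

Lemma enorm_ge0 x : 0 <= enorm x.
Proof. exact: sqrtr_ge0. Qed.

Lemma enorm_sqr x : enorm x ^+ 2 = dotv x x.
Proof. by rewrite sqr_sqrtr ?dotvv_ge0. Qed.

Lemma enormN x : enorm (- x) = enorm x.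
Proof. by rewrite /enorm !dotvE opprK. Qed.

Lemma enormB x y : enorm (x - y) = enorm (y - x).
Proof. by rewrite -enormN opprB. Qed.

Lemma enormZ t x : enorm (t *: x) = `|t| * enorm x.
Proof. by rewrite /enorm !dotvE mulrA -expr2 sqrtrM ?sqr_ge0// sqrtr_sqr. Qed.

(** Cauchy-Schwarz inequality. *)
Lemma dotv_le x y : dotv x y <= enorm x * enorm y.
Proof.
have [y0|y0] := eqVneq (dotv y y) 0.
  by rewrite (dotvv_eq0 y0) -(scale0r (0 : 'rV[R]_n)) dotvZr enormZ normr0 mul0r
             mul0r mulr0.
have ygt0 : 0 < dotv y y by rewrite lt_def y0 dotvv_ge0.
apply: le_trans (ler_norm _) _.
rewrite -ler_sqr ?nnegrE ?mulr_ge0 ?enorm_ge0// real_normK ?num_real//.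
rewrite exprMn !enorm_sqr -subr_ge0 -(pmulr_rge0 _ ygt0).
(* the square of the component of x orthogonal to y, rescaled *)
have := dotvv_ge0 (dotv y y *: x - dotv x y *: y).
rewrite !dotvE (dotvC y x); congr (_ <= _); ring.
Qed.

Lemma enorm_triangle x y : enorm (x + y) <= enorm x + enorm y.
Proof.
rewrite -ler_sqr ?nnegrE ?addr_ge0 ?enorm_ge0//.
rewrite sqrrD !enorm_sqr !dotvE (dotvC y x).
by have := dotv_le x y; lra.
Qed.

Lemma enorm_triangleB z x y : enorm (x - y) <= enorm (x - z) + enorm (z - y).
Proof. by apply: le_trans (enorm_triangle _ _); rewrite addrA subrK. Qed.

End Euclidean.

(** * Quadratic bounds from a Lipschitz gradient *)

Section Descent.
Context {R : realType} {n : nat}.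
Implicit Types (x y v : 'rV[R]_n) (h : 'rV[R]_n -> R) (A : set 'rV[R]_n).

Lemma convex_set_segment A x y (t : R) : convex_set A -> A x -> A y ->
  0 <= t <= 1 -> A (x + t *: (y - x)).
Proof.
move=> Aconv Ax Ay /andP[t0 t1].
have := Aconv y x (Itv01 t0 t1) (mem_set Ay) (mem_set Ax) => /set_mem.
congr A; change (t *: y + (1 - t) *: x = x + t *: (y - x)).
by rewrite scalerBr scalerBl scale1r addrCA.
Qed.

(** The gradient is made of partial derivatives; for a differentiable function
these determine every directional derivative by linearity. *)
Lemma derive_dotv_grad h a v : differentiable h a -> 'd h a v = dotv (grad h a) v.
Proof.
move=> dh; rewrite {1}(row_sum_delta v) linear_sum; apply: eq_bigr => i _.
by rewrite linearZ/= mxE deriveE// mulrC.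
Qed.

Lemma is_derive_line h x v (t : R) : differentiable h (x + t *: v) ->
  is_derive t 1 (fun s : R => h (x + s *: v)) (dotv (grad h (x + t *: v)) v).
Proof.
move=> dh; pose l (s : R) := x + s *: v.
have dl : is_diff (t : R^o) l (fun s : R => s *: v).
  by apply: is_diff_eq; rewrite add0r.
have dlt : differentiable l t by exact: ex_diff.
apply: DeriveDef; first exact/diff_derivable/differentiable_comp.
rewrite deriveE; last exact: differentiable_comp.
by rewrite (diff_comp dlt dh)/= derive_dotv_grad// diff_val scale1r.
Qed.

(** The mean value theorem is applied along the segment to the gap phi between h
and its claimed quadratic majorant: by Cauchy-Schwarz and the Lipschitz bound,
the derivative of phi is nonpositive. *)
Lemma descent h A (L : R) x y : convex_set A -> 0 <= L ->
  (forall z, A z -> differentiable h z) -> elipschitz_on A L (grad h) ->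
  A x -> A y ->
  h y <= h x + dotv (grad h x) (y - x) + L / 2 * enorm (y - x) ^+ 2.
Proof.
move=> Aconv L0 dh hL Ax Ay; set v := y - x.
pose phi (t : R) := h (x + t *: v) - (dotv (grad h x) v * t
  + L / 2 * enorm v ^+ 2 * t ^+ 2).
pose dphi (t : R) := dotv (grad h (x + t *: v)) v - (dotv (grad h x) v
  + L * enorm v ^+ 2 * t).
have dphiP (t : R) : 0 <= t <= 1 -> is_derive t 1 phi (dphi t).
  move=> t01; have At := convex_set_segment Aconv Ax Ay t01.
  have ? := is_derive_line (dh _ At).
  apply: is_derive_eq; rewrite /dphi /GRing.scale/=; congr (_ - _).
  by field.
have [c] : exists2 c, c \in `]0, 1[ & phi 1 - phi 0 = dphi c * (1 - 0).
  apply: MVT => [|t|]; first exact: ltr01.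
    by rewrite in_itv/= => /andP[t0 t1]; apply: dphiP; rewrite !ltW.
  apply: derivable_within_continuous => t; rewrite in_itv/= => t01.
  by have [] := dphiP _ t01.
rewrite in_itv/= => /andP[c0 c1]; rewrite subr0 mulr1 => dE.
have c01 : 0 <= c <= 1 by rewrite !ltW.
have : dphi c <= 0.
  rewrite /dphi opprD addrA -dotvNl -dotvDl subr_le0.
  apply: le_trans (dotv_le _ _) _.
  have := hL _ _ (convex_set_segment Aconv Ax Ay c01) Ax.
  rewrite addrAC subrr add0r enormZ ger0_norm ?(ltW c0)// => le.
  have := ler_wpM2r (enorm_ge0 v) le; rewrite -/v; lra.
have xv : x + v = y by rewrite addrC subrK.
rewrite -dE /phi scale0r scale1r addr0 xv; lra.
Qed.

Lemma gradN h a : differentiable h a -> grad (- h) a = - grad h a.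
Proof.
by move=> dh; apply/rowP => i; rewrite !mxE deriveN//; exact: diff_derivable.
Qed.

Lemma descent_lower h A (L : R) x y : convex_set A -> 0 <= L ->
  (forall z, A z -> differentiable h z) -> elipschitz_on A L (grad h) ->
  A x -> A y ->
  h x + dotv (grad h x) (y - x) - L / 2 * enorm (y - x) ^+ 2 <= h y.
Proof.
move=> Aconv L0 dh hL Ax Ay.
have dNh z : A z -> differentiable (- h) z by move=> /dh; exact: differentiableN.
have NhL : elipschitz_on A L (grad (- h)).
  move=> u w Au Aw; rewrite !gradN; [|exact: dh..].
  by rewrite -opprD enormN; exact: hL.
have := descent Aconv L0 dNh NhL Ax Ay.
rewrite gradN; last exact: dh.
by rewrite !opprfctE dotvNl; lra.
Qed.

End Descent.

(** * A domain without boundary *)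

Section FullDomain.
Context {R : realType} {n : nat}.
Implicit Types (x y : 'rV[R]_n) (f : 'rV[R]_n -> \bar R).

Lemma dotv_continuous (u w : 'rV[R]_n -> 'rV[R]_n) :
  continuous u -> continuous w -> continuous (fun y => dotv (u y) (w y)).
Proof.
move=> cu cw; rewrite /dotv; elim: (index_enum _) => [|i s IHs] y.
  under eq_fun do rewrite big_nil; exact: cst_continuous.
under eq_fun do rewrite big_cons; apply: continuousD (IHs y).
apply: continuousM.
  by apply: (@continuous_comp _ _ _ u (fun v : 'rV[R]_n => v 0 i));
    [exact: cu|exact: coord_continuous].
by apply: (@continuous_comp _ _ _ w (fun v : 'rV[R]_n => v 0 i));
  [exact: cw|exact: coord_continuous].
Qed.

(** On its domain, f lies below a quadratic q.  Were f infinite at a limit point b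
of the domain, lower semicontinuity would make f exceed q(b) + 1 near b, which
contradicts f <= q at the nearby points of the domain.  So the domain is closed;
it is also open, and connectedness of segments makes it the whole space. *)
Lemma edom_setT f (L : R) : proper_fun f -> lower_semicontinuous f ->
  differentiable_on_dom f -> convex_set (edom f) -> 0 <= L ->
  elipschitz_on (edom f) L (grad (fine \o f)) -> edom f = setT.
Proof.
move=> [fNy [x0 fx0]] f_lsc df fconv L0 fL; set A := edom f.
pose phi := fine \o f.
have fE z : A z -> f z = (phi z)%:E.
  by move=> Az; rewrite fineK// fin_numE fNy lt_eqF.
pose q y := phi x0 + dotv (grad phi x0) (y - x0)
  + L / 2 * dotv (y - x0) (y - x0).
have q_cont : continuous q.
  have c1 : continuous (fun y => y - x0) by move=> y; apply: continuousB;
    [exact: cvg_id|exact: cst_continuous].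
  have c2 : continuous (fun y => dotv (grad phi x0) (y - x0)).
    by apply: dotv_continuous => //; exact: cst_continuous.
  have c3 := dotv_continuous c1 c1.
  move=> y; apply: (@continuousD _ _ _ (fun y => phi x0 + dotv (grad phi x0) (y - x0))
    (fun y => L / 2 * dotv (y - x0) (y - x0))).
    by apply: (@continuousD _ _ _ (cst (phi x0))); [exact: cst_continuous|exact: c2].
  by apply: (@continuousM _ _ (cst (L / 2))); [exact: cst_continuous|exact: c3].
have f_le y : A y -> phi y <= q y.
  move=> Ay; rewrite /q -enorm_sqr; apply: (descent (A := A)) => // z Az.
  by have [] := df z Az.
have A_open : open A by rewrite openE => y Ay; have [] := df y Ay.
have A_closed : closed A.
  rewrite -(setCK A); apply: open_closedC; rewrite openE => b Ab.
  have fb : ((q b + 1)%:E < f b)%E.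
    by move/negP: Ab; rewrite -leNgt leye_eq => /eqP ->; rewrite ltry.
  have [V Vb Vf] := f_lsc _ _ fb.
  have qb : nbhs b [set y | q y < q b + 1].
    have : nbhs (q b) [set r | r < q b + 1].
      by apply: (@lt_nbhsl _ (q b)); rewrite ltrDl.
    exact: q_cont.
  apply: filterS (filterI Vb qb) => y [/Vf fy /= qy] Ay.
  have := f_le _ Ay; rewrite leNgt => /negP; apply.
  by apply: lt_trans qy _; rewrite -lte_fin -(fE _ Ay).
rewrite -subTset => z _.
pose l (t : R) := x0 + t *: (z - x0).
have l_cont : continuous l.
  move=> t; apply: (@continuousD _ _ _ (cst x0) (fun t : R => t *: (z - x0))).
    exact: cst_continuous.
  by apply: continuousZr_tmp; exact: cvg_id.
suff -> : z = l 1.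
  suff : `[0, 1]%classic `<=` l @^-1` A by apply; rewrite /= in_itv/= lexx ler01.
  suff <- : `[0, 1]%classic `&` l @^-1` A = `[0, 1]%classic by exact: subIsetr.
  apply: segment_connected.
  - by exists 0; split; rewrite /= ?in_itv/= ?lexx ?ler01// /l scale0r addr0.
  - by exists (l @^-1` A) => //; apply: open_comp => // t _; exact: l_cont.
  - by exists (l @^-1` A) => //; apply: closed_comp => // t _; exact: l_cont.
by rewrite /l scale1r addrC subrK.
Qed.

End FullDomain.

(** * Strong convexity and the Bregman distance *)

Section Bregman.
Context {R : realType} {n : nat}.
Implicit Types (x y : 'rV[R]_n) (K : 'rV[R]_n -> R).

Lemma convex_setTv : convex_set [set: 'rV[R]_n].
Proof. by move=> x y t _ _; exact: in_setT. Qed.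

(** In dimension 0 a Lipschitz constant may be negative; its absolute value is
always a valid nonnegative one. *)
Lemma elipschitz_on_norm (A : set 'rV[R]_n) (M : R) G :
  elipschitz_on A M G -> elipschitz_on A `|M| G.
Proof.
move=> GM x y Ax Ay; apply: le_trans (GM _ _ Ax Ay) _.
by apply: ler_wpM2r; rewrite ?enorm_ge0// ler_norm.
Qed.

(** Strong convexity bounds K at x + t (y - x) from above and the Lipschitz gradient
bounds it from below; dividing by t, the two bounds give the claim up to an
error that is linear in t. *)
Lemma bregman_ge K (m M : R) x y : (forall z, differentiable K z) -> 0 <= m ->
  strongly_convex m K -> elipschitz_on setT M (grad K) ->
  m / 2 * enorm (y - x) ^+ 2 <= bregman K x y.
Proof.
move=> dK m0 Kconv /elipschitz_on_norm KM.
set e := enorm (y - x) ^+ 2; have e0 : 0 <= e by exact: sqr_ge0.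
pose s := (`|M| + m) / 2 * e.
have s0 : 0 <= s by rewrite mulr_ge0 ?divr_ge0 ?addr_ge0.
apply/ler_addgt0Pr => d d0.
(* a step in ]0, 1] small enough for the error t * s to be at most d *)
pose t := d / (d + s).
have t0 : 0 < t by rewrite divr_gt0// ltr_wpDr.
have t1 : t <= 1 by rewrite ler_pdivrMr ?mul1r ?lerDl// ltr_wpDr.
have ts : t * s <= d.
  rewrite /t mulrAC ler_pdivrMr ?ltr_wpDr//.
  by apply: ler_wpM2l; [exact: ltW|rewrite lerDr ltW].
have low := @descent_lower _ _ K setT `|M| x (x + t *: (y - x)) convex_setTv
  (normr_ge0 _) (fun z _ => dK z) KM I I.
have up := Kconv y x t; rewrite (ltW t0) t1 -/e in up; have {up} := up isT.
have -> : t *: y + (1 - t) *: x = x + t *: (y - x).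
  by rewrite scalerBr scalerBl scale1r addrCA.
move=> up; move: low.
have -> : x + t *: (y - x) - x = t *: (y - x) by rewrite addrAC subrr add0r.
rewrite dotvZr enormZ (gtr0_norm t0) exprMn -/e => low.
rewrite /bregman; move: up low ts; rewrite /s.
set k := dotv _ _; set Kt := K (_ + _) => up low ts.
have {up low} : 0 <= t * (K y - K x - k - m / 2 * (1 - t) * e + `|M| / 2 * t * e).
  by lra.
rewrite pmulr_rge0// => ?; lra.
Qed.

End Bregman.

(** * Distance to a set *)

Section Distance.
Context {R : realType} {n : nat}.
Implicit Types (x y z : 'rV[R]_n) (C : set 'rV[R]_n).

Lemma edist_set_le x z C : C z -> (edist_set x C <= (enorm (x - z))%:E)%E.
Proof. by move=> Cz; apply: ereal_inf_lbound; exists z. Qed.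

Lemma edist_set_ge0 x C : (0 <= edist_set x C)%E.
Proof. by apply/ereal_infP => _ [z _ <-]; rewrite lee_fin enorm_ge0. Qed.

Lemma edist_set_fin x z C : C z -> edist_set x C \is a fin_num.
Proof.
move=> Cz; rewrite ge0_fin_numE ?edist_set_ge0//.
exact: le_lt_trans (edist_set_le x Cz) (ltry _).
Qed.

Lemma edist_set_lip x y C :
  (edist_set x C <= (enorm (x - y))%:E + edist_set y C)%E.
Proof.
rewrite -leeBlDl//; apply/ereal_infP => _ [z Cz <-].
rewrite leeBlDl// -EFinD; apply: le_trans (edist_set_le x Cz) _.
by rewrite lee_fin; exact: enorm_triangleB.
Qed.

End Distance.

(** * Inequalities between real powers *)

Section Powers.
Context {R : realType}.
Implicit Types a b c d r p q t gamma : R.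

Lemma powR_le_linear t d q : 0 <= t <= d -> 1 <= q ->
  t `^ q <= d `^ (q - 1) * t.
Proof.
move=> /andP[t0 td] q1; rewrite -mulr_powRB1 ?(lt_le_trans ltr01)// mulrC.
rewrite ler_wpM2r// ge0_ler_powR ?subr_ge0// nnegrE//.
exact: le_trans td.
Qed.

Lemma powRD_le a b p : 0 <= a -> 0 <= b -> 0 <= p ->
  (a + b) `^ p <= 2 `^ p * (a `^ p + b `^ p).
Proof.
move=> a0 b0 p0; have m0 : 0 <= Num.max a b by rewrite le_max a0.
apply: (@le_trans _ _ ((2 * Num.max a b) `^ p)).
  apply: ge0_ler_powR; rewrite ?nnegrE ?addr_ge0 ?mulr_ge0//.
  by rewrite mulr_natl mulr2n lerD// le_max lexx ?orbT.
rewrite powRM// ler_wpM2l ?powR_ge0//.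
by rewrite /Num.max; case: ifP => _; rewrite ?lerDl ?lerDr powR_ge0.
Qed.

(** The arithmetic of the theorem: a and b stand for the distances of x and y to
the level set, r for |x - y|.  Since p and p / gamma are at least 1, the powers
of r that appear are linear in r on the bounded range [0, d]. *)
Lemma powR_error_transfer a b c d r gamma p :
  0 < gamma -> 1 <= p -> gamma <= p -> 0 <= c -> 0 <= a -> 0 <= b ->
  0 <= r <= d -> a <= r + b -> b `^ gamma <= c * r ->
  a `^ p <= 2 `^ p * (d `^ (p - 1) + c `^ (p / gamma) * d `^ (p / gamma - 1)) * r.
Proof.
move=> g0 p1 gp c0 a0 b0 /[dup] rd /andP[r0 _] ab br.
have p0 : 0 <= p by exact: le_trans p1.
have q1 : 1 <= p / gamma by rewrite ler_pdivlMr// mul1r.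
apply: (@le_trans _ _ ((r + b) `^ p)).
  by apply: ge0_ler_powR; rewrite ?nnegrE ?addr_ge0.
apply: le_trans (powRD_le r0 b0 p0) _.
rewrite -mulrA ler_wpM2l ?powR_ge0// mulrDl lerD ?powR_le_linear//.
have -> : b `^ p = (b `^ gamma) `^ (p / gamma).
  by rewrite -powRrM mulrCA divff ?mulr1// gt_eqF.
apply: (@le_trans _ _ ((c * r) `^ (p / gamma))).
  by apply: ge0_ler_powR; rewrite ?nnegrE ?(le_trans ler01 q1) ?powR_ge0 ?mulr_ge0.
by rewrite powRM// -mulrA ler_wpM2l ?powR_ge0// powR_le_linear.
Qed.

End Powers.

(** * The Bregman proximal step *)

Section ProximalStep.
Context {R : realType} {n : nat}.
Context (f g : 'rV[R]_n -> \bar R) (K : 'rV[R]_n -> R) (L m M eps : R)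
  (f_fin : forall z, f z \is a fin_num)
  (f_diff : forall z, differentiable (fine \o f) z)
  (L_ge0 : 0 <= L)
  (f_lip : elipschitz_on setT L (grad (fine \o f)))
  (g_Ny : forall z, g z != -oo%E)
  (K_diff : forall z, differentiable K z)
  (m_ge0 : 0 <= m)
  (K_convex : strongly_convex m K)
  (K_lip : elipschitz_on setT M (grad K))
  (eps_gt0 : 0 < eps).

Local Notation phi := (fine \o f).
Implicit Types x y z : 'rV[R]_n.

Let g_fin z : (g z < +oo)%E -> g z \is a fin_num.
Proof. by move=> gz; rewrite fin_numE g_Ny lt_eqF. Qed.

Lemma bregman_prox_le x y z : bregman_prox f g K eps x y -> (g z < +oo)%E ->
  (g y < +oo)%E /\
  dotv (grad phi x) (y - x) + fine (g y) + bregman K x y / eps <=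
  dotv (grad phi x) (z - x) + fine (g z) + bregman K x z / eps.
Proof.
move=> /(_ z) + /g_fin gz; rewrite /= -(fineK gz) -!EFinD => le_yz.
have gy : (g y < +oo)%E.
  by move: le_yz; case: (g y) (g_Ny y) => //= r _; rewrite ltry.
split=> //; move: le_yz; rewrite -(fineK (g_fin gy)) -!EFinD lee_fin.
by rewrite !div1r !(mulrC eps^-1).
Qed.

(** Optimality of y against the competitor x: the quadratic lower bound of
D(x, y) / eps outweighs the quadratic error of the linearisation of f at x by
the coefficient m / eps - L. *)
Lemma bregman_prox_decrease x y :
  bregman_prox f g K eps x y -> (g x < +oo)%E ->
  (g y < +oo)%E /\
  (m / eps - L) / 2 * enorm (y - x) ^+ 2 <=
  (phi x + fine (g x)) - (phi y + fine (g y)).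
Proof.
move=> /bregman_prox_le le_prox /[dup] gx /le_prox[gy le_yx]; split=> //.
have := descent (@convex_setTv R n) L_ge0 (fun z _ => f_diff z) f_lip
  (I : setT x) (I : setT y).
have := bregman_ge x y K_diff m_ge0 K_convex K_lip.
move: le_yx; have -> : bregman K x x = 0.
  by rewrite /bregman subrr -(scale0r 0) dotvZr mul0r addr0 subrr.
rewrite subrr -(scale0r 0) dotvZr !mul0r.
set e := enorm _ ^+ 2; set D := bregman _ _ _; set k := dotv _ _.
move=> le_yx; rewrite -(ler_pM2r (_ : 0 < eps^-1)) ?invr_gt0// => De fe.
lra.
Qed.

(** The first-order condition 0 = grad f(x) + v + (grad K(y) - grad K(x)) / eps
singles out a candidate subgradient v of g at y, and xi = grad f(y) + v.
Optimality of y against z bounds g from below near y; smoothness of f and K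
costs only a quadratic term, which proximal subgradients tolerate. *)
Lemma bregman_prox_subdiff x y :
  bregman_prox f g K eps x y -> (g x < +oo)%E ->
  exists2 xi, prox_subdiff (fun z => f z + g z)%E y xi &
    enorm xi <= (L + `|M| / eps) * enorm (x - y).
Proof.
move=> prox_y /(bregman_prox_le prox_y)[gy _].
have M_lip := elipschitz_on_norm K_lip.
pose xi := (grad phi y - grad phi x) - eps^-1 *: (grad K y - grad K x).
exists xi; last first.
  apply: le_trans (enorm_triangle _ _) _.
  rewrite enormN enormZ gtr0_norm ?invr_gt0// mulrDl lerD//.
    by rewrite enormB; exact: f_lip.
  by rewrite mulrAC [leRHS]mulrC ler_wpM2l ?invr_ge0 ?(ltW eps_gt0)// enormB;
    exact: M_lip.
(* the 1 only makes the quadratic constant positive *)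
exists ((L + `|M| / eps) / 2 + 1), 1; split=> [|//|z _].
  by rewrite ltr_wpDl// divr_ge0// addr_ge0// divr_ge0// ltW.
rewrite -(fineK (f_fin y)) -(fineK (f_fin z)) -(fineK (g_fin gy)).
have [gz|] := boolP (g z < +oo)%E; last first.
  by rewrite -leNgt leye_eq => /eqP ->; rewrite addey// leey.
rewrite -(fineK (g_fin gz)) -!EFinD lee_fin.
have := descent_lower (@convex_setTv R n) L_ge0 (fun z _ => f_diff z) f_lip
  (I : setT y) (I : setT z).
have := descent (@convex_setTv R n) (normr_ge0 M) (fun z _ => K_diff z) M_lip
  (I : setT y) (I : setT z).
have [_] := bregman_prox_le prox_y gz.
rewrite /bregman /xi.
set e := enorm _ ^+ 2; have e0 : 0 <= e by exact: sqr_ge0.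
rewrite /= !dotvE => opt Kz fz.
have := ler_wpM2l (ltW (_ : 0 < eps^-1)) Kz; rewrite invr_gt0 => /(_ eps_gt0).
lra.
Qed.

End ProximalStep.

(** * The error bound for the proximal step *)

Theorem theorem3p1 (R : realType) (n : nat)
    (f g : 'rV[R]_n -> \bar R) (K : 'rV[R]_n -> R)
    (L m M eps_lo eps_hi eps : R)
    (xbar : 'rV[R]_n) (gamma eta nu : R)
    (f_proper : proper_fun f)
    (f_lsc : lower_semicontinuous f)
    (f_diff : differentiable_on_dom f)
    (f_dom_convex : convex_set (edom f))
    (L_gt0 : 0 < L)
    (f_lip : elipschitz_on (edom f) L (grad (fine \o f)))
    (g_proper : proper_fun g)
    (g_lsc : lower_semicontinuous g)
    (g_cont : {within edom g, continuous g})
    (g_dom_convex : convex_set (edom g))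
    (F_level_bounded : level_bounded (fun x => f x + g x)%E)
    (K_diff2 : twice_differentiable K)
    (m_gt0 : 0 < m)
    (K_convex : strongly_convex m K)
    (K_lip : elipschitz_on setT M (grad K))
    (eps_lo_gt0 : 0 < eps_lo)
    (eps_range : eps_lo <= eps <= eps_hi)
    (eps_hi_lt : eps_hi < m / L)
    (xbar_dom : edom (fun x => f x + g x)%E xbar)
    (gamma_gt0 : 0 < gamma) (eta_gt0 : 0 < eta) (nu_gt0 : 0 < nu)
    (error_bound : level_subdiff_error_bound (fun x => f x + g x)%E xbar gamma eta nu) :
  let p := 1 / Num.min (1 / gamma) 1 in
  (exists N theta : R,
    [/\ (2 * eps_hi * nu / (m - eps_hi * L)) / (eta / 2) ^+ 2 < N,
        0 < theta &
        forall x, level_ball (fun x => f x + g x)%E xbar (eta / 2) (nu / N) x ->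
          (edist_set x (level_set (fun x => f x + g x)%E (f xbar + g xbar)%E) `^ p <=
           theta%:E * edist_set x (bregman_prox f g K eps x))%E])
  /\ (gamma <= 1 -> p = 1)
  /\ (1 < gamma -> p = gamma).

Proof.
move=> p.
have [p1 gp pE1 pE2] :
    [/\ 1 <= p, gamma <= p, gamma <= 1 -> p = 1 & 1 < gamma -> p = gamma].
  have gi0 : 0 < gamma^-1 by rewrite invr_gt0.
  rewrite /p !div1r; have [g1|g1] := leP gamma 1.
    by rewrite min_r ?invr1 ?lexx ?invf_ge1//; split=> //; rewrite ltNge g1.
  by rewrite min_l ?invrK ?lexx ?(ltW g1) ?invf_le1// ?ltW//; split=> //;
    rewrite leNgt g1.
split; last by [].
have p0 : 0 <= p by exact: le_trans p1.
have /andP[lo_eps eps_hi_ge] := eps_range.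
have eps_gt0 : 0 < eps by exact: lt_le_trans lo_eps.
have eps_hi_gt0 : 0 < eps_hi by exact: lt_le_trans eps_hi_ge.
have hiL : eps_hi * L < m by rewrite -ltr_pdivlMr.
have epsL : eps * L <= eps_hi * L by rewrite ler_pM2r.
have f_dom := edom_setT f_proper f_lsc f_diff f_dom_convex (ltW L_gt0) f_lip.
have f_fin z : f z \is a fin_num.
  have : edom f z by rewrite f_dom.
  by move=> fz; rewrite fin_numE f_proper.1 lt_eqF.
have f_diffT z : differentiable (fine \o f) z.
  by have [] := f_diff z; rewrite ?f_dom.
have f_lipT : elipschitz_on setT L (grad (fine \o f)) by rewrite -f_dom.
have g_Ny := g_proper.1.
have g_dom z (a : \bar R) : (f z + g z < a)%E -> (g z < +oo)%E.
  move=> Fz; rewrite ltey; apply: contraTneq Fz => ->.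
  by rewrite addey ?ltNge ?leey// -ltNye ltNye_eq f_fin.
pose F z := (fine \o f) z + fine (g z).
have FE z : (g z < +oo)%E -> (f z + g z)%E = (F z)%:E.
  move=> gz; have g_fin : g z \is a fin_num by rewrite fin_numE g_Ny lt_eqF.
  by rewrite /F EFinD/= (fineK (f_fin z)) (fineK g_fin).
have [c3 c3_gt0 eb] := error_bound.
pose c := c3 * (L + `|M| / eps).
have c_ge0 : 0 <= c 
  by rewrite mulr_ge0 ?(ltW c3_gt0)// addr_ge0 ?divr_ge0 ?(ltW L_gt0) ?(ltW eps_gt0).
set d := eta / 2; have d0 : 0 < d by rewrite divr_gt0.
set B := _ / _ ^+ 2; have B0 : 0 <= B.
  rewrite divr_ge0 ?sqr_ge0// divr_ge0 ?subr_ge0 ?(ltW hiL)//.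
  by rewrite !mulr_ge0 ?(ltW eps_hi_gt0) ?(ltW nu_gt0).
pose theta := 2 `^ p * (d `^ (p - 1) + c `^ (p / gamma) * d `^ (p / gamma - 1)).
have theta_ge : d `^ (p - 1) <= theta.
  apply: (@le_trans _ _ (1 * (d `^ (p - 1) +
    c `^ (p / gamma) * d `^ (p / gamma - 1)))).
    by rewrite mul1r lerDl mulr_ge0 ?powR_ge0.
  rewrite ler_wpM2r ?addr_ge0 ?mulr_ge0 ?powR_ge0//.
  by have := ler_powR (ler1n R 2) p0; rewrite powRr0.
have theta0 : 0 < theta by apply: lt_le_trans theta_ge; exact: powR_gt0.
(* the modulus of decrease at the largest parameter; N is tuned so that the
   resulting step is shorter than d = eta / 2 *)
pose kappa := (m - eps_hi * L) / eps_hi.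
have kappa0 : 0 < kappa by rewrite divr_gt0// subr_gt0.
have kappa_le : kappa <= m / eps - L.
  rewrite /kappa mulrBl mulrAC divff ?gt_eqF// mul1r lerD2r ler_pM2l//.
  by rewrite lef_pV2 ?posrE.
have nuN_lt : nu / (B + 1) < kappa / 2 * d ^+ 2.
  rewrite ltr_pdivrMr ?ltr_wpDl// mulrDr mulr1.
  have -> : kappa / 2 * d ^+ 2 * B = nu.
    rewrite /kappa /B; field; rewrite !gt_eqF// subr_gt0//.
  by rewrite ltrDl mulr_gt0 ?exprn_gt0// divr_gt0.
(* B + 1 exceeds B strictly, and also 1, so that nu / N <= nu *)
exists (B + 1), theta; split=> //; first by rewrite ltrDl.
move=> x [/= x_ball /andP[Fx_gt Fx_lt]].
set C := level_set _ _.
have gx := g_dom _ _ Fx_lt; have gxbar := g_dom _ _ xbar_dom.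
have Cxbar : C xbar by rewrite /C /level_set/=.
have C_fin z := edist_set_fin z Cxbar.
have dist_ge0 z : 0 <= fine (edist_set z C) by rewrite fine_ge0// edist_set_ge0.
have dist_x : fine (edist_set x C) <= d.
  rewrite -lee_fin fineK//; apply: le_trans (edist_set_le x Cxbar) _.
  by rewrite lee_fin ltW.
rewrite -lee_pdivrMl//; apply/ereal_infP => _ [y prox_y <-].
rewrite lee_pdivrMl// -(fineK (C_fin x)) poweR_EFin -EFinM lee_fin.
have [Fy|Fy] := leP (f y + g y)%E (f xbar + g xbar)%E.
  have dist_xy : fine (edist_set x C) <= enorm (x - y).
    by rewrite -lee_fin fineK//; exact: edist_set_le.
  have dist_0d : 0 <= fine (edist_set x C) <= d by rewrite dist_ge0.
  apply: le_trans (powR_le_linear dist_0d p1) _.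
  by apply: ler_pM => //; rewrite powR_ge0.
have [gy decr] := bregman_prox_decrease f_diffT (ltW L_gt0) f_lipT g_Ny
  K_diff2.1 (ltW m_gt0) K_convex K_lip eps_gt0 prox_y gx.
rewrite -/(F x) -/(F y) in decr; move: Fx_gt Fx_lt Fy; rewrite !FE// -EFinD !lte_fin.
move=> Fx_gt Fx_lt Fy_gt.
have r_lt : enorm (x - y) < d.
  rewrite -(@ltr_pXn2r _ 2) ?nnegrE ?enorm_ge0 ?(ltW d0)// enormB.
  have k2 : 0 < kappa / 2 by rewrite divr_gt0.
  rewrite -(ltr_pM2l k2).
  have FxFy : F x - F y < nu / (B + 1) by lra.
  apply: le_lt_trans (lt_trans FxFy nuN_lt); apply: le_trans decr.
  by rewrite ler_wpM2r ?sqr_ge0// ler_wpM2r ?invr_ge0.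
have y_ball : level_ball (fun z => f z + g z)%E xbar eta nu y.
  split; rewrite /eball/=.
    apply: le_lt_trans (enorm_triangleB x _ _) _.
    by move: r_lt x_ball; rewrite /eball/= (enormB x y) /d; lra.
  rewrite !FE// -EFinD !lte_fin Fy_gt/=.
  have : 0 <= F x - F y.
    apply: le_trans decr; rewrite mulr_ge0 ?sqr_ge0// divr_ge0//.
    exact: le_trans (ltW kappa0) kappa_le.
  have : nu / (B + 1) <= nu by rewrite ler_pdivrMr ?ltr_wpDl// ler_peMr ?lerDr// ltW.
  lra.
have [xi xiP xi_le] := bregman_prox_subdiff f_fin f_diffT (ltW L_gt0) f_lipT g_Ny
  K_diff2.1 K_lip eps_gt0 prox_y gx.
apply: (@powR_error_transfer _ _ (fine (edist_set y C)) c) => //.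
- by rewrite enorm_ge0 ltW.
- by rewrite -lee_fin EFinD !fineK//; exact: edist_set_lip.
- have := eb _ y_ball; rewrite -/C -(fineK (C_fin y)) poweR_EFin => ebd.
  rewrite -lee_fin; apply: le_trans ebd _.
  apply: (@le_trans _ _ (c3%:E * (enorm (0 - xi))%:E)%E).
    by rewrite lee_pmul2l//; exact: edist_set_le.
  by rewrite -EFinM lee_fin sub0r enormN /c -mulrA ler_pM2l.
Qed.
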